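(* Let the initial gas density $\rho_G(0,r)=\rho_0(r)$ and initial gas velocity $v_G(0,r)=v_0(r)$ belong to $C^1(\mathbb R^+)$ and be such that $W_0'(r)<0$ or $Z_0'(r)<0$, where $$W_0(r)=v_0(r)-\frac{2c_0(r)}{\gamma-1},\qquad Z_0(r)=v_0(r)+\frac{2c_0(r)}{\gamma-1},\qquad c_0(r)=\sqrt{\gamma\,(r^2\rho_0(r))^{\gamma-1}},\qquad \gamma>1 .$$ Let $(\rho_G,v_G)$ be the corresponding solution of the gas system described in the context, defined on the finite time interval $[0,T[$. Then the Cauchy problem $$\frac{dR(t)}{dt}=\frac{v_G(t,R(t))\,\rho_G(t,R(t))}{\rho_G(t,R(t))-\rho_L},\qquad R(0)=R_0,$$ has a unique solution $R(t)$ on a maximal time interval $[0,T^*[$ with $T^*\le T$.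
   Context: Here $\rho_G(t,r)$ and $v_G(t,r)$ are the density and radial velocity of the gas surrounding a spherical droplet, $\rho_L$ is the density of the liquid, $R(t)$ is the droplet radius and $R_0$ is its initial value. The gas system is, with $\rho(t,r)=r^2\rho_G(t,r)$ and $v(t,r)=v_G(t,r)$, $$\partial_t\rho+v\,\partial_r\rho+\rho\,\partial_r v=0,\qquad \partial_t v+v\,\partial_r v+\gamma\rho^{\gamma-2}\,\partial_r\rho=0 .$$ Its Riemann invariants are $W=v-\frac{2c}{\gamma-1}$ and $Z=v+\frac{2c}{\gamma-1}$ with $c=\sqrt{\gamma\rho^{\gamma-1}}$; $W_0$ and $Z_0$ are their values at $t=0$. The paper asserts beforehand that, if $W_0'<0$ or $Z_0'<0$, the solution of the gas system is defined on a finite time interval $[0,T[$, and that for $\rho_0,v_0\in C^1(\mathbb R^+)$ the system (written in terms of $W$ and $Z$) has a unique $C^1$ solution on $[0,T[$ for all $r\in\mathbb R^+$; this $T$ is the one in the claim. *)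

(* Defs.v *)
From Stdlib Require Import Reals Lra.
From Coquelicot Require Import Coquelicot.
Open Scope R_scope.

(* The space variable ranges over the open half-line [0 < r] and the time
   variable over the half-open interval [0,T[; derivatives in time at [t = 0]
   are therefore one-sided, which is what [D_in] on [time_dom T] expresses. *)
Definition time_dom (T : R) (t : R) : Prop := 0 <= t < T.

Definition gas_dom (T : R) (p : R * R) : Prop :=
  time_dom T (fst p) /\ 0 < snd p.

Definition C1_Rplus (f : R -> R) : Prop :=
  forall r, 0 < r -> ex_derive f r /\ continuous (Derive f) r.

(* [f] is of class C^1 on [0,T[ x ]0,+oo[, with partial derivatives [ft]
   (in time) and [fr] (in space). *)
Definition C1_with_partials (T : R) (f ft fr : R -> R -> R) : Prop :=
  (forall t r, gas_dom T (t, r) ->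
     D_in (fun s => f s r) (fun s => ft s r) (time_dom T) t /\
     is_derive (fun x => f t x) r (fr t r)) /\
  continuous_on (gas_dom T) (fun p => ft (fst p) (snd p)) /\
  continuous_on (gas_dom T) (fun p => fr (fst p) (snd p)).

(* Real power x^a of a nonnegative base; [Rpower 0 a] is 1, whereas
   0^a = 0 for a > 0. *)
Definition rpow (x a : R) : R := if Rlt_dec 0 x then Rpower x a else 0.

Definition sound_speed (gamma rho : R) : R :=
  sqrt (gamma * rpow rho (gamma - 1)).

Definition riemannW (gamma rho v : R) : R :=
  v - 2 * sound_speed gamma rho / (gamma - 1).

Definition riemannZ (gamma rho v : R) : R :=
  v + 2 * sound_speed gamma rho / (gamma - 1).

(* Vacuum is not excluded.  For gamma <= 2 the value of rho^(gamma-2) at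
   rho = 0 is immaterial: rho is nonnegative, so d rho/dr vanishes there. *)
Definition gas_solution (gamma T : R) (rhoG vG : R -> R -> R) : Prop :=
  (forall t r, gas_dom T (t, r) -> 0 <= rhoG t r) /\
  exists rho_t rho_r v_t v_r : R -> R -> R,
    let rho := fun t r => r ^ 2 * rhoG t r in
    C1_with_partials T rho rho_t rho_r /\
    C1_with_partials T vG v_t v_r /\
    forall t r, gas_dom T (t, r) ->
      rho_t t r + vG t r * rho_r t r + rho t r * v_r t r = 0 /\
      v_t t r + vG t r * v_r t r
        + gamma * rpow (rho t r) (gamma - 2) * rho_r t r = 0.

(* A solution on [0,S[ stays where the right-hand side is defined:
   [0 < Rad t] and [rhoG t (Rad t) <> rhoL]. *)
Definition radius_solution (rhoG vG : R -> R -> R) (rhoL R0 S : R)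
    (Rad : R -> R) : Prop :=
  Rad 0 = R0 /\
  forall t, time_dom S t ->
    0 < Rad t /\
    rhoG t (Rad t) <> rhoL /\
    D_in Rad
      (fun s => vG s (Rad s) * rhoG s (Rad s) / (rhoG s (Rad s) - rhoL))
      (time_dom S) t.

(* Main.v *)
(* The right-hand side v rho / (rho - rhoL) is continuous in time and locally
   Lipschitz in r wherever r > 0 and rho <> rhoL, because rho and v are C^1; so
   Picard iteration gives a solution near t = 0, and two solutions agree on
   their common interval of existence.  The maximal solution is the common
   extension of all solutions, and Tstar the supremum of their lifespans. *)
Require Import Defs.
From Stdlib Require Import Reals Lra Lia Classical ClassicalEpsilon.
From Coquelicot Require Import Coquelicot.
Open Scope R_scope.

(** * Functions locally Lipschitz in space *)

(** The right-hand side lives only on part of [0,T[ x ]0,+oo[, with one-sided time at 0, whereas the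
    integral operator of Picard is easiest to handle on the whole line. Composing with retractions
    of time and space onto a small closed box makes the field globally bounded and Lipschitz, and a
    lifespan of at most (box radius)/(speed bound) keeps the solution where the retractions are the
    identity. Continuity in t at each fixed r, together with a Lipschitz bound in r uniform in t,
    already gives continuity along continuous curves, so [regular_at] asks for no joint continuity.
    Convergence and uniqueness both work on intervals of length at most 1/(2K), where one mean value
    estimate halves a difference; this replaces Gronwall's inequality. *)

(* Local regularity sufficient for the Cauchy-Lipschitz theorem: the single
   constant K is both a bound and a Lipschitz constant in r. *)
Definition regular_at (D : R -> Prop) (f : R -> R -> R) (t0 r0 : R) : Prop :=
  exists d K, 0 < d /\ 0 < K /\
    forall t, D t -> Rabs (t - t0) < d ->
    forall r, Rabs (r - r0) < d ->
      Rabs (f t r) <= K /\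
      limit1_in (fun s => f s r) D (f t r) t /\
      forall r', Rabs (r' - r0) < d ->
        Rabs (f t r - f t r') <= K * Rabs (r - r').

Lemma limit1_in_elim (f : R -> R) D l x eps :
  limit1_in f D l x -> 0 < eps ->
  exists d, 0 < d /\ forall s, D s -> Rabs (s - x) < d -> Rabs (f s - l) < eps.
Proof.
intros H He. destruct (H eps He) as [d [Hd H']].
exists d; split; [exact Hd|]. intros s Hs Hsx. exact (H' s (conj Hs Hsx)).
Qed.

Lemma limit1_in_intro (f : R -> R) D l x :
  (forall eps, 0 < eps -> exists d, 0 < d /\
     forall s, D s -> Rabs (s - x) < d -> Rabs (f s - l) < eps) ->
  limit1_in f D l x.
Proof.
intros H eps He. destruct (H eps He) as [d [Hd H']].
exists d; split; [exact Hd|]. intros s [Hs Hsx]. exact (H' s Hs Hsx).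
Qed.

Lemma regular_at_sub D f g t0 r0 :
  regular_at D f t0 r0 -> regular_at D g t0 r0 ->
  regular_at D (fun t r => f t r - g t r) t0 r0.
Proof.
intros [d1 [K1 [Hd1 [HK1 H1]]]] [d2 [K2 [Hd2 [HK2 H2]]]].
exists (Rmin d1 d2), (K1 + K2).
split; [now apply Rmin_glb_lt|]. split; [lra|].
intros t Dt Ht r Hr.
apply Rmin_Rgt in Ht; apply Rmin_Rgt in Hr.
destruct (H1 t Dt (proj1 Ht) r (proj1 Hr)) as [B1 [C1 L1]].
destruct (H2 t Dt (proj2 Ht) r (proj2 Hr)) as [B2 [C2 L2]].
split; [|split].
- eapply Rle_trans; [apply Rabs_triang|]. rewrite Rabs_Ropp. lra.
- now apply limit_minus.
- intros r' Hr'. apply Rmin_Rgt in Hr'.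
  specialize (L1 r' (proj1 Hr')); specialize (L2 r' (proj2 Hr')).
  replace (f t r - g t r - (f t r' - g t r'))
    with ((f t r - f t r') - (g t r - g t r')) by ring.
  eapply Rle_trans; [apply Rabs_triang|]. rewrite Rabs_Ropp. lra.
Qed.

Lemma regular_at_mul D f g t0 r0 :
  regular_at D f t0 r0 -> regular_at D g t0 r0 ->
  regular_at D (fun t r => f t r * g t r) t0 r0.
Proof.
intros [d1 [K1 [Hd1 [HK1 H1]]]] [d2 [K2 [Hd2 [HK2 H2]]]].
(* [K1 * K2] bounds the product; the factor 2 comes from the two terms of the product rule in the
   Lipschitz estimate. *)
exists (Rmin d1 d2), (2 * (K1 * K2)).
assert (0 < K1 * K2) by now apply Rmult_lt_0_compat.
split; [now apply Rmin_glb_lt|]. split; [lra|].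
intros t Dt Ht r Hr.
apply Rmin_Rgt in Ht; apply Rmin_Rgt in Hr.
destruct (H1 t Dt (proj1 Ht) r (proj1 Hr)) as [B1 [C1 L1]].
destruct (H2 t Dt (proj2 Ht) r (proj2 Hr)) as [B2 [C2 L2]].
split; [|split].
- rewrite Rabs_mult.
  apply Rle_trans with (K1 * K2); [|lra].
  apply Rmult_le_compat; auto using Rabs_pos.
- now apply limit_mul.
- intros r' Hr'. apply Rmin_Rgt in Hr'.
  specialize (L1 r' (proj1 Hr')); specialize (L2 r' (proj2 Hr')).
  destruct (H2 t Dt (proj2 Ht) r' (proj2 Hr')) as [B2' _].
  replace (f t r * g t r - f t r' * g t r')
    with (f t r * (g t r - g t r') + (f t r - f t r') * g t r') by ring.
  eapply Rle_trans; [apply Rabs_triang|]. rewrite !Rabs_mult.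
  replace (2 * (K1 * K2) * Rabs (r - r'))
    with (K1 * (K2 * Rabs (r - r')) + K1 * Rabs (r - r') * K2) by ring.
  apply Rplus_le_compat; apply Rmult_le_compat; auto using Rabs_pos.
Qed.

(** Moving in time along r = r0 costs at most a quarter of |f t0 r0| by continuity, then moving in
    space another quarter by the Lipschitz bound; half of it remains. *)
Lemma regular_at_lower_bound (D : R -> Prop) f t0 r0 :
  D t0 -> regular_at D f t0 r0 -> f t0 r0 <> 0 ->
  exists d m, 0 < d /\ 0 < m /\
    forall t r, D t -> Rabs (t - t0) < d -> Rabs (r - r0) < d -> m <= Rabs (f t r).
Proof.
intros Dt0 [d [K [Hd [HK H]]]] Hf.
assert (Hm : 0 < Rabs (f t0 r0)) by now apply Rabs_pos_lt.
set (m := Rabs (f t0 r0)) in *.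
assert (Z0 : Rabs (t0 - t0) < d) by (rewrite Rminus_diag, Rabs_R0; exact Hd).
assert (Z1 : Rabs (r0 - r0) < d) by (rewrite Rminus_diag, Rabs_R0; exact Hd).
destruct (H t0 Dt0 Z0 r0 Z1) as [_ [C _]].
destruct (limit1_in_elim _ _ _ _ (m / 4) C) as [e [He C']]; [lra|].
assert (Hq : 0 < m / 4 / K) by (apply Rdiv_lt_0_compat; lra).
exists (Rmin (Rmin d e) (m / 4 / K)), (m / 2).
split; [repeat apply Rmin_glb_lt; assumption|]. split; [lra|].
intros t r Dt Ht Hr.
apply Rmin_Rgt in Ht; destruct Ht as [Ht _]; apply Rmin_Rgt in Ht.
apply Rmin_Rgt in Hr; destruct Hr as [Hr Hr']; apply Rmin_Rgt in Hr.
destruct (H t Dt (proj1 Ht) r (proj1 Hr)) as [_ [_ L]].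
specialize (L r0 Z1). specialize (C' t Dt (proj2 Ht)).
assert (K * Rabs (r - r0) <= m / 4).
{ apply Rle_trans with (K * (m / 4 / K)).
  - apply Rmult_le_compat_l; lra.
  - right; field; lra. }
unfold m in *.
assert (T := Rabs_triang (f t0 r0 - f t r0) (f t r0 - f t r)).
assert (T' := Rabs_triang (f t0 r0 - f t r) (f t r)).
replace (f t0 r0 - f t r0 + (f t r0 - f t r)) with (f t0 r0 - f t r) in T by ring.
replace (f t0 r0 - f t r + f t r) with (f t0 r0) in T' by ring.
rewrite (Rabs_minus_sym (f t0 r0) (f t r0)), (Rabs_minus_sym (f t r0) (f t r)) in T.
lra.
Qed.

Lemma regular_at_inv (D : R -> Prop) f t0 r0 :
  D t0 -> regular_at D f t0 r0 -> f t0 r0 <> 0 ->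
  regular_at D (fun t r => / f t r) t0 r0.
Proof.
intros Dt0 Hreg Hf.
destruct (regular_at_lower_bound D f t0 r0 Dt0 Hreg Hf) as [e [m [He [Hm Hlow]]]].
destruct Hreg as [d [K [Hd [HK H]]]].
assert (Hi : 0 < / m) by now apply Rinv_0_lt_compat.
assert (Hii : 0 < K * (/ m * / m)) by (repeat apply Rmult_lt_0_compat; assumption).
(* The first term bounds 1/f; the second is its Lipschitz constant, from 1/a - 1/b = (b -
   a)/(ab). *)
exists (Rmin d e), (/ m + K * (/ m * / m)).
split; [now apply Rmin_glb_lt|]. split; [lra|].
intros t Dt Ht r Hr.
apply Rmin_Rgt in Ht; apply Rmin_Rgt in Hr.
destruct (H t Dt (proj1 Ht) r (proj1 Hr)) as [_ [C L]].
assert (Inv : forall r, Rabs (r - r0) < e -> f t r <> 0 /\ Rabs (/ f t r) <= / m).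
{ intros x Hx. assert (M := Hlow t x Dt (proj2 Ht) Hx). split.
  - intros E. rewrite E, Rabs_R0 in M. lra.
  - rewrite Rabs_inv. now apply Rinv_le_contravar. }
destruct (Inv r (proj2 Hr)) as [N I].
split; [lra|]. split; [now apply limit_inv|].
intros r' Hr'. apply Rmin_Rgt in Hr'. specialize (L r' (proj1 Hr')).
destruct (Inv r' (proj2 Hr')) as [N' I'].
replace (/ f t r - / f t r') with ((f t r' - f t r) * (/ f t r * / f t r'))
  by (field; auto).
rewrite !Rabs_mult, (Rabs_minus_sym (f t r')).
apply Rle_trans with (K * Rabs (r - r') * (/ m * / m)).
- apply Rmult_le_compat; auto using Rabs_pos.
  + apply Rmult_le_pos; apply Rabs_pos.
  + apply Rmult_le_compat; auto using Rabs_pos.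
- assert (P := Rmult_le_pos (/ m) (Rabs (r - r')) (Rlt_le _ _ Hi) (Rabs_pos _)).
  lra.
Qed.

Lemma regular_at_time_independent D (g : R -> R) L t0 r0 :
  (forall r r', Rabs (g r - g r') <= L * Rabs (r - r')) ->
  regular_at D (fun _ r => g r) t0 r0.
Proof.
intros HL.
exists 1, (Rabs L + Rabs (g r0) + 1).
assert (PL := Rabs_pos L). assert (Pg := Rabs_pos (g r0)). assert (LL := Rle_abs L).
split; [lra|]. split; [lra|].
intros t Dt Ht r Hr. split; [|split].
- assert (T := Rabs_triang (g r - g r0) (g r0)).
  replace (g r - g r0 + g r0) with (g r) in T by ring.
  assert (HL' := HL r r0).
  assert (L * Rabs (r - r0) <= Rabs L * Rabs (r - r0))
    by (apply Rmult_le_compat_r; auto using Rabs_pos).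
  assert (Rabs L * Rabs (r - r0) <= Rabs L * 1)
    by (apply Rmult_le_compat_l; lra).
  lra.
- exact (limit_free g D r t).
- intros r' Hr'. eapply Rle_trans; [apply HL|].
  apply Rmult_le_compat_r; [apply Rabs_pos|lra].
Qed.

(** Equality is asked only for r near r0 because the intended use cancels powers of r, which needs r
    away from 0. *)
Lemma regular_at_ext D f g t0 r0 e :
  0 < e ->
  (forall t r, D t -> Rabs (r - r0) < e -> f t r = g t r) ->
  regular_at D f t0 r0 -> regular_at D g t0 r0.
Proof.
intros He E [d [K [Hd [HK H]]]].
exists (Rmin d e), K. split; [now apply Rmin_glb_lt|]. split; [exact HK|].
intros t Dt Ht r Hr.
apply Rmin_Rgt in Ht; apply Rmin_Rgt in Hr.
destruct (H t Dt (proj1 Ht) r (proj1 Hr)) as [B [C L]].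
rewrite <- (E t r Dt (proj2 Hr)). split; [exact B|]. split.
- intros eps Heps. destruct (C eps Heps) as [a [Ha C']].
  exists a; split; [exact Ha|]. intros s Hs.
  rewrite <- (E s r (proj1 Hs) (proj2 Hr)). now apply C'.
- intros r' Hr'. apply Rmin_Rgt in Hr'.
  rewrite <- (E t r' Dt (proj2 Hr')). now apply L.
Qed.

(** [cont_deriv] yields a limit over the domain with x removed; the point x itself is put back
    here. *)
Lemma D_in_continuous f d D x : D_in f d D x -> limit1_in f D (f x) x.
Proof.
intros H. apply limit1_in_intro. intros eps He.
destruct (cont_deriv f d D x H eps He) as [a [Ha C]].
exists a; split; [exact Ha|]. intros s Ds Hs.
destruct (Req_dec s x) as [->|N].
- now rewrite Rminus_diag, Rabs_R0.
- apply C. split; [split; auto|exact Hs].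
Qed.

Lemma mean_value_bound f f' a b K :
  (forall x, Rmin a b <= x <= Rmax a b -> is_derive f x (f' x) /\ Rabs (f' x) <= K) ->
  Rabs (f b - f a) <= K * Rabs (b - a).
Proof.
intros H. destruct (MVT_gen f a b f') as [c [Hc E]].
- intros x Hx. apply H. lra.
- intros x Hx. apply derivable_continuous_pt. exists (f' x).
  apply is_derive_Reals. now apply H.
- rewrite E, Rabs_mult. apply Rmult_le_compat_r; [apply Rabs_pos|now apply H].
Qed.

(** Joint continuity bounds the space derivative near the point, and the mean value theorem in r
    turns this bound into a Lipschitz constant that is uniform in t. *)
Lemma regular_at_C1 T f ft fr t0 r0 :
  C1_with_partials T f ft fr -> gas_dom T (t0, r0) ->
  regular_at (time_dom T) f t0 r0.
Proof.
intros [HD [_ Hr]] Hdom. destruct (Hdom) as [Dt0 Pr0]; simpl in Dt0, Pr0.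
destruct (Hr (t0, r0) Hdom (ball (fr t0 r0) (mkposreal 1 Rlt_0_1)))
  as [[e He] Hball].
{ now exists (mkposreal 1 Rlt_0_1). }
assert (Bd : forall t r, gas_dom T (t, r) -> Rabs (t - t0) < e ->
  Rabs (r - r0) < e -> Rabs (fr t r) <= Rabs (fr t0 r0) + 1).
{ intros t r Hd Ht Hrr.
  assert (B : Rabs (fr t r - fr t0 r0) < 1).
  { exact (Hball (t, r) (conj Ht Hrr) Hd). }
  assert (Tr := Rabs_triang (fr t r - fr t0 r0) (fr t0 r0)).
  replace (fr t r - fr t0 r0 + fr t0 r0) with (fr t r) in Tr by ring. lra. }
assert (Cont : forall t r, gas_dom T (t, r) ->
  limit1_in (fun s => f s r) (time_dom T) (f t r) t).
{ intros t r Hd. apply (D_in_continuous (fun s => f s r) (fun s => ft s r)). now apply HD. }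
destruct (limit1_in_elim _ _ _ _ 1 (Cont t0 r0 Hdom) Rlt_0_1) as [e' [He' C']].
(* [e] controls the space derivative and [e'] the time variation at r0; the bound 1 makes the
   Lipschitz contribution to |f| at most [K], and the bound [r0] keeps r positive. *)
set (d := Rmin (Rmin e e') (Rmin 1 r0)).
assert (Hd : d <= e /\ d <= e' /\ d <= 1 /\ d <= r0).
{ assert (A1 := Rmin_l (Rmin e e') (Rmin 1 r0)).
  assert (A2 := Rmin_r (Rmin e e') (Rmin 1 r0)).
  assert (A3 := Rmin_l e e'). assert (A4 := Rmin_r e e').
  assert (A5 := Rmin_l 1 r0). assert (A6 := Rmin_r 1 r0).
  unfold d. lra. }
assert (Pd : 0 < d) by (unfold d; repeat apply Rmin_glb_lt; lra).
set (K := Rabs (fr t0 r0) + 1).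
assert (PK := Rabs_pos (fr t0 r0)). assert (Pf := Rabs_pos (f t0 r0)).
assert (Lip : forall t r r', time_dom T t -> Rabs (t - t0) < d ->
  Rabs (r - r0) < d -> Rabs (r' - r0) < d ->
  Rabs (f t r - f t r') <= K * Rabs (r - r')).
{ intros t r r' Dt Ht Hr1 Hr2.
  apply (mean_value_bound (f t) (fr t)). intros x Hx.
  assert (Hx' : Rabs (x - r0) < d).
  { apply Rabs_def2 in Hr1, Hr2. apply Rabs_def1;
    unfold Rmin, Rmax in Hx; destruct (Rle_dec r' r); lra. }
  assert (gas_dom T (t, x)).
  { split; [exact Dt|simpl]. apply Rabs_def2 in Hx'. lra. }
  split; [now apply HD|]. apply Bd; auto; lra. }
exists d, (K + Rabs (f t0 r0) + 1).
split; [exact Pd|]. split; [unfold K; lra|].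
intros t Dt Ht r Hr1. split; [|split].
- assert (Z : Rabs (r0 - r0) < d) by (rewrite Rminus_diag, Rabs_R0; exact Pd).
  assert (L := Lip t r r0 Dt Ht Hr1 Z).
  assert (C := C' t Dt ltac:(lra)).
  assert (K * Rabs (r - r0) <= K * 1) by (apply Rmult_le_compat_l; unfold K; lra).
  assert (T1 := Rabs_triang (f t r - f t r0) (f t r0)).
  assert (T2 := Rabs_triang (f t r0 - f t0 r0) (f t0 r0)).
  replace (f t r - f t r0 + f t r0) with (f t r) in T1 by ring.
  replace (f t r0 - f t0 r0 + f t0 r0) with (f t r0) in T2 by ring.
  lra.
- apply Cont. split; [exact Dt|simpl]. apply Rabs_def2 in Hr1. lra.
- intros r' Hr2. eapply Rle_trans; [now apply Lip|].
  apply Rmult_le_compat_r; [apply Rabs_pos|lra].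
Qed.

(** * Picard iteration *)

(** A 1-Lipschitz retraction of the line onto [a,b]: precomposing with it extends a function beyond
    [a,b] without changing its bound or Lipschitz constant. *)
Definition clamp (a b x : R) : R := Rmax a (Rmin b x).

Lemma clamp_bounds a b x : a <= b -> a <= clamp a b x <= b.
Proof.
intros H. unfold clamp. split; [apply Rmax_l|].
apply Rmax_lub; [exact H|apply Rmin_l].
Qed.

Lemma clamp_id a b x : a <= x <= b -> clamp a b x = x.
Proof. intros H. unfold clamp. rewrite Rmin_right, Rmax_right; lra. Qed.

Lemma clamp_lipschitz a b x y : Rabs (clamp a b x - clamp a b y) <= Rabs (x - y).
Proof.
unfold clamp, Rmax, Rmin.
destruct (Rle_dec b x), (Rle_dec b y);
  repeat (match goal with |- context [Rle_dec ?u ?v] => destruct (Rle_dec u v) end);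
  unfold Rabs; repeat (match goal with |- context [Rcase_abs ?u] => destruct (Rcase_abs u) end);
  lra.
Qed.

Lemma continuous_intro (f : R -> R) x :
  (forall eps, 0 < eps -> exists d, 0 < d /\
     forall y, Rabs (y - x) < d -> Rabs (f y - f x) < eps) ->
  continuous f x.
Proof.
intros H. apply filterlim_locally. intros [eps He].
destruct (H eps He) as [d [Hd H']].
exists (mkposreal d Hd). intros y Hy. exact (H' y Hy).
Qed.

Lemma continuous_elim (f : R -> R) x eps :
  continuous f x -> 0 < eps -> exists d, 0 < d /\
    forall y, Rabs (y - x) < d -> Rabs (f y - f x) < eps.
Proof.
intros H He.
destruct (proj1 (filterlim_locally f (f x)) H (mkposreal eps He)) as [[d Hd] H'].
exists d; split; [exact Hd|]. intros y Hy. exact (H' y Hy).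
Qed.

Lemma geometric_eventually_lt C eps :
  0 <= C -> 0 < eps -> exists N, forall n, (N <= n)%nat -> C * (1 / 2) ^ n < eps.
Proof.
intros HC He.
assert (H2 : Rabs (1 / 2) < 1) by (rewrite Rabs_pos_eq; lra).
assert (Hq : 0 < eps / (C + 1)) by (apply Rdiv_lt_0_compat; lra).
destruct (pow_lt_1_zero (1 / 2) H2 _ Hq) as [N HN].
exists N. intros n Hn. specialize (HN n Hn).
assert (P : 0 <= (1 / 2) ^ n) by (apply pow_le; lra).
rewrite Rabs_pos_eq in HN by exact P.
apply Rle_lt_trans with ((C + 1) * (1 / 2) ^ n); [lra|].
replace eps with ((C + 1) * (eps / (C + 1))) at 1 by (field; lra).
apply Rmult_lt_compat_l; lra.
Qed.

Lemma geometric_bound_zero C a :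
  0 <= C -> (forall n, Rabs a <= C * (1 / 2) ^ n) -> a = 0.
Proof.
intros HC H. destruct (Req_dec a 0) as [|N]; [assumption|].
destruct (geometric_eventually_lt C (Rabs a) HC (Rabs_pos_lt a N)) as [n Hn].
specialize (Hn n (le_n n)); specialize (H n); lra.
Qed.

Lemma geometric_uniform_limit (Y : nat -> R -> R) C :
  0 <= C -> (forall n t, Rabs (Y (S n) t - Y n t) <= C * (1 / 2) ^ n) ->
  exists y, forall n t, Rabs (y t - Y n t) <= 2 * C * (1 / 2) ^ n.
Proof.
intros HC Hstep.
(* The factor 1 - (1/2)^p is that of the exact partial geometric sum; with it the induction on p
   closes. *)
assert (Htail : forall n p t, Rabs (Y (p + n)%nat t - Y n t) <= 2 * C * (1 / 2) ^ n * (1 - (1 / 2) ^ p)).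
{ intros n p t. induction p as [|p IH].
  - simpl. rewrite Rminus_diag, Rabs_R0. lra.
  - change (S p + n)%nat with (S (p + n)). assert (S1 := Hstep (p + n)%nat t).
    assert (T := Rabs_triang (Y (S (p + n)) t - Y (p + n)%nat t) (Y (p + n)%nat t - Y n t)).
    replace (Y (S (p + n)) t - Y (p + n)%nat t + (Y (p + n)%nat t - Y n t))
      with (Y (S (p + n)) t - Y n t) in T by ring.
    rewrite pow_add in S1. simpl pow. lra. }
assert (Htail' : forall n p t, Rabs (Y (p + n)%nat t - Y n t) <= 2 * C * (1 / 2) ^ n).
{ intros n p t. eapply Rle_trans; [apply Htail|].
  assert (P : 0 <= (1 / 2) ^ p) by (apply pow_le; lra).
  assert (Q : 0 <= (1 / 2) ^ n) by (apply pow_le; lra).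
  rewrite <- (Rmult_1_r (2 * C * (1 / 2) ^ n)) at 2.
  apply Rmult_le_compat_l; [|lra]. apply Rmult_le_pos; lra. }
assert (Hex : forall t, ex_finite_lim_seq (fun n => Y n t)).
{ intros t. apply ex_lim_seq_cauchy_corr. intros [eps He]; simpl.
  destruct (geometric_eventually_lt (2 * C) (eps / 2)) as [N HN]; [lra|lra|].
  exists N. intros n m Hn Hm. specialize (HN N (le_n N)).
  assert (A1 := Htail' N (n - N)%nat t). assert (A2 := Htail' N (m - N)%nat t).
  replace (n - N + N)%nat with n in A1 by lia.
  replace (m - N + N)%nat with m in A2 by lia.
  assert (T := Rabs_triang (Y n t - Y N t) (Y N t - Y m t)).
  replace (Y n t - Y N t + (Y N t - Y m t)) with (Y n t - Y m t) in T by ring.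
  rewrite (Rabs_minus_sym (Y N t) (Y m t)) in T. lra. }
exists (fun t => real (Lim_seq (fun n => Y n t))). intros n t.
assert (L := Lim_seq_correct' _ (Hex t)).
apply Rle_plus_epsilon. intros eps He.
apply is_lim_seq_spec in L. destruct (L (mkposreal eps He)) as [N HN]; simpl in HN.
specialize (HN (N + n)%nat ltac:(lia)). assert (A := Htail' n N t).
set (l := real (Lim_seq (fun n => Y n t))) in *.
assert (T := Rabs_triang (l - Y (N + n)%nat t) (Y (N + n)%nat t - Y n t)).
replace (l - Y (N + n)%nat t + (Y (N + n)%nat t - Y n t)) with (l - Y n t) in T by ring.
rewrite (Rabs_minus_sym l (Y (N + n)%nat t)) in T. lra.
Qed.

Lemma continuous_uniform_limit (Y : nat -> R -> R) y C :
  0 <= C -> (forall n t, Rabs (y t - Y n t) <= C * (1 / 2) ^ n) ->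
  (forall n t, continuous (Y n) t) -> forall t, continuous y t.
Proof.
intros HC Hy Hc t. apply continuous_intro. intros eps He.
destruct (geometric_eventually_lt C (eps / 3)) as [n Hn]; [exact HC|lra|].
specialize (Hn n (le_n n)).
destruct (continuous_elim (Y n) t (eps / 3) (Hc n t)) as [d [Hd H]]; [lra|].
exists d; split; [exact Hd|]. intros s Hs. specialize (H s Hs).
assert (A1 := Hy n s). assert (A2 := Hy n t).
replace (y s - y t) with ((y s - Y n s) + (Y n s - Y n t) + (Y n t - y t)) by ring.
assert (T1 := Rabs_triang (y s - Y n s + (Y n s - Y n t)) (Y n t - y t)).
assert (T2 := Rabs_triang (y s - Y n s) (Y n s - Y n t)).
rewrite (Rabs_minus_sym (Y n t) (y t)) in T1. lra.
Qed.

(* The iterates are frozen outside [0,h], so that all estimates hold on the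
   whole real line. *)
Lemma picard (G : R -> R -> R) (r0 B K h : R) :
  0 < h -> 0 < K -> K * h <= 1 / 2 ->
  (forall t r, Rabs (G t r) <= B) ->
  (forall t r r', Rabs (G t r - G t r') <= K * Rabs (r - r')) ->
  (forall t r, continuous (fun s => G s r) t) ->
  exists z, z 0 = r0 /\ forall t, 0 <= t <= h -> is_derive z t (G t (z t)).
Proof.
intros Hh HK HKh HB HL HC.
assert (HB0 : 0 <= B) by (eapply Rle_trans; [apply Rabs_pos|apply (HB 0 0)]).
assert (HBh : 0 <= B * h) by (apply Rmult_le_pos; lra).
assert (Gcomp : forall y : R -> R, (forall t, continuous y t) ->
  forall t, continuous (fun s => G s (y s)) t).
{ intros y Hy t. apply continuous_intro. intros eps He.
  assert (Hq : 0 < eps / 2 / K) by (apply Rdiv_lt_0_compat; lra).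
  destruct (continuous_elim y t _ (Hy t) Hq) as [d1 [Hd1 H1]].
  destruct (continuous_elim _ t (eps / 2) (HC t (y t))) as [d2 [Hd2 H2]]; [lra|].
  exists (Rmin d1 d2). split; [now apply Rmin_glb_lt|].
  intros s Hs. apply Rmin_Rgt in Hs.
  specialize (H1 s (proj1 Hs)); specialize (H2 s (proj2 Hs)).
  assert (L := HL s (y s) (y t)).
  assert (K * Rabs (y s - y t) < eps / 2).
  { replace (eps / 2) with (K * (eps / 2 / K)) by (field; lra).
    now apply Rmult_lt_compat_l. }
  assert (T := Rabs_triang (G s (y s) - G s (y t)) (G s (y t) - G t (y t))).
  replace (G s (y s) - G s (y t) + (G s (y t) - G t (y t)))
    with (G s (y s) - G t (y t)) in T by ring. lra. }
set (Phi := fun (y : R -> R) t => r0 + RInt (fun s => G s (y s)) 0 t).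
assert (Phi0 : forall y, Phi y 0 = r0).
{ intros y. unfold Phi. rewrite RInt_point. unfold zero; simpl. ring. }
assert (dPhi : forall y : R -> R, (forall t, continuous y t) ->
  forall t, is_derive (Phi y) t (G t (y t))).
{ intros y Hy t. unfold Phi.
  replace (G t (y t)) with (0 + G t (y t)) by ring.
  apply (is_derive_plus (fun _ => r0) (RInt (fun s => G s (y s)) 0)).
  - exact (is_derive_const (V := R_NormedModule) r0 t).
  - apply (is_derive_RInt (fun s => G s (y s)) _ 0).
    + exists (mkposreal 1 Rlt_0_1). intros s _.
      apply (RInt_correct (V := R_CompleteNormedModule)).
      apply ex_RInt_continuous. intros u _. now apply Gcomp.
    + now apply Gcomp. }
(* The difference of the two images vanishes at 0 and has derivative at most [K * M], so on [0,h] it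
   is at most [K * M * h], hence at most M/2. *)
assert (Contr : forall (y z : R -> R) M, (forall t, continuous y t) -> (forall t, continuous z t) ->
  (forall t, Rabs (y t - z t) <= M) ->
  forall t, 0 <= t <= h -> Rabs (Phi y t - Phi z t) <= M / 2).
{ intros y z M Hy Hz HM t Ht.
  assert (HM0 : 0 <= M) by (eapply Rle_trans; [apply Rabs_pos|apply (HM 0)]).
  assert (V := mean_value_bound (fun s => Phi y s - Phi z s)
    (fun s => G s (y s) - G s (z s)) 0 t (K * M)).
  cbv beta in V. rewrite !Phi0 in V.
  replace (Phi y t - Phi z t - (r0 - r0)) with (Phi y t - Phi z t) in V by ring.
  eapply Rle_trans; [apply V|].
  - intros s _. split.
    + apply (is_derive_minus (Phi y) (Phi z)); now apply dPhi.
    + eapply Rle_trans; [apply HL|]. apply Rmult_le_compat_l; [lra|apply HM].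
  - rewrite Rminus_0_r, Rabs_pos_eq by lra.
    apply Rle_trans with (K * M * h).
    + apply Rmult_le_compat_l; [apply Rmult_le_pos; lra|lra].
    + replace (K * M * h) with (M * (K * h)) by ring.
      replace (M / 2) with (M * (1 / 2)) by field.
      now apply Rmult_le_compat_l. }
set (Y := nat_rect (fun _ => R -> R) (fun _ : R => r0)
  (fun _ y t => Phi y (clamp 0 h t))).
assert (Cl : forall t, 0 <= clamp 0 h t <= h) by (intros t; apply clamp_bounds; lra).
assert (YC : forall n t, continuous (Y n) t).
{ induction n as [|n IH]; intros t.
  - apply continuous_const.
  - apply (continuous_comp (clamp 0 h) (Phi (Y n))).
    + apply continuous_intro. intros eps He. exists eps; split; [exact He|].
      intros s Hs. eapply Rle_lt_trans; [apply clamp_lipschitz|exact Hs].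
    + apply (ex_derive_continuous (Phi (Y n))). eexists. now apply dPhi. }
assert (Ystep : forall n t, Rabs (Y (S n) t - Y n t) <= B * h * (1 / 2) ^ n).
{ induction n as [|n IH]; intros t.
  - assert (V := mean_value_bound (Phi (fun _ => r0)) (fun s => G s r0)
      0 (clamp 0 h t) B).
    rewrite Phi0 in V. simpl. rewrite Rmult_1_r.
    eapply Rle_trans; [apply V|].
    + intros s _. split; [|apply HB].
      apply (dPhi (fun _ => r0)). intros u; apply continuous_const.
    + apply Rmult_le_compat_l; [exact HB0|].
      specialize (Cl t). rewrite Rabs_pos_eq; lra.
  - replace (B * h * (1 / 2) ^ S n) with (B * h * (1 / 2) ^ n / 2) by (simpl; field).
    apply (Contr (Y (S n)) (Y n)); auto. }
destruct (geometric_uniform_limit Y (B * h) HBh Ystep) as [y Hy].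
assert (yC : forall t, continuous y t).
{ apply (continuous_uniform_limit Y y (2 * (B * h))); auto; lra. }
(* Both sides are within a multiple of (1/2)^n of [Y (S n) t], for every n. *)
assert (Fix : forall t, 0 <= t <= h -> Phi y t = y t).
{ intros t Ht. apply Rminus_diag_uniq.
  apply (geometric_bound_zero (2 * (B * h))); [lra|]. intros n.
  assert (A1 := Contr y (Y n) _ yC (YC n) (Hy n) t Ht).
  assert (A2 := Hy (S n) t).
  assert (E : Y (S n) t = Phi (Y n) t).
  { simpl. now rewrite clamp_id. }
  rewrite E in A2. simpl pow in A2.
  assert (T := Rabs_triang (Phi y t - Phi (Y n) t) (Phi (Y n) t - y t)).
  replace (Phi y t - Phi (Y n) t + (Phi (Y n) t - y t)) with (Phi y t - y t) in T by ring.
  rewrite (Rabs_minus_sym (Phi (Y n) t) (y t)) in T. lra. }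
(* The witness is [Phi y] rather than [y]: the limit [y] is frozen outside [0,h] and may have
   corners at 0 and h, whereas [Phi y] is differentiable everywhere. *)
exists (Phi y). split; [apply Phi0|]. intros t Ht.
rewrite (Fix t Ht). now apply dPhi.
Qed.

(** * Maximal solutions *)

(** A relative derivative depends only on the germ at x. This one form serves to shrink a time
    interval, to pass to a full neighbourhood of an interior time, and to glue solutions. *)
Lemma D_in_local (f g d d' : R -> R) (D D' : R -> Prop) x e :
  0 < e -> D' x ->
  (forall s, D' s -> Rabs (s - x) < e -> D s /\ g s = f s) ->
  d' x = d x -> D_in f d D x -> D_in g d' D' x.
Proof.
intros He Dx Hs Hd H eps Heps.
destruct (H eps Heps) as [a [Ha H']].
exists (Rmin a e). split; [now apply Rmin_glb_lt|].
intros s [[Ds N] Hx]. simpl in *. unfold Rdist in *.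
apply Rmin_Rgt in Hx.
destruct (Hs s Ds (proj2 Hx)) as [Ds' E].
destruct (Hs x Dx) as [_ E']; [now rewrite Rminus_diag, Rabs_R0|].
rewrite E, E', Hd. apply H'. split; [split; assumption|apply Hx].
Qed.

Lemma is_derive_D_in f d D x : is_derive f x (d x) -> D_in f d D x.
Proof.
intros H. apply is_derive_Reals, derivable_pt_lim_D_in in H.
refine (limit1_imp _ _ _ _ _ _ H).
intros y [_ N]; split; [exact I|exact N].
Qed.

Lemma D_in_is_derive f d S t :
  0 < t < S -> D_in f d (time_dom S) t -> is_derive f t (d t).
Proof.
intros Ht H. apply is_derive_Reals, derivable_pt_lim_D_in.
apply (D_in_local f f d d (time_dom S) no_cond t (Rmin t (S - t))).
- apply Rmin_glb_lt; lra.
- exact I.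
- intros s _ Hs. apply Rmin_Rgt in Hs. destruct Hs as [A1 A2].
  apply Rabs_def2 in A1, A2. split; [split; lra|reflexivity].
- reflexivity.
- exact H.
Qed.

(** The derivative at a may be one-sided (a = 0), so the two-sided inequality is applied on [a',b]
    with a' > a, and the gap between a and a' is absorbed by continuity. *)
Lemma D_in_mean_value_bound f d S a b K :
  0 <= a <= b -> b < S ->
  (forall t, a <= t <= b -> D_in f d (time_dom S) t /\ Rabs (d t) <= K) ->
  Rabs (f b - f a) <= K * (b - a).
Proof.
intros Hab HS H.
destruct (Req_dec a b) as [<-|N]; [rewrite !Rminus_diag, Rabs_R0; lra|].
assert (HK : 0 <= K).
{ eapply Rle_trans; [apply Rabs_pos|apply (H a); lra]. }
apply Rle_plus_epsilon. intros eps He.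
assert (C : limit1_in f (time_dom S) (f a) a).
{ apply (D_in_continuous f d). apply H. lra. }
destruct (limit1_in_elim _ _ _ _ eps C He) as [e [Pe C']].
set (a' := a + Rmin (e / 2) (b - a)).
assert (0 < Rmin (e / 2) (b - a)) by (apply Rmin_glb_lt; lra).
assert (A1 := Rmin_l (e / 2) (b - a)). assert (A2 := Rmin_r (e / 2) (b - a)).
assert (Ha' : a < a' <= b /\ a' < a + e) by (unfold a'; lra).
clearbody a'.
assert (V : Rabs (f b - f a') <= K * Rabs (b - a')).
{ apply (mean_value_bound f d). intros x.
  rewrite Rmin_left, Rmax_right by lra. intros Hx.
  destruct (H x) as [H1 H2]; [lra|].
  split; [|exact H2]. apply (D_in_is_derive f d S); [lra|exact H1]. }
rewrite (Rabs_pos_eq (b - a')) in V by lra.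
assert (C2 : Rabs (f a' - f a) < eps).
{ apply C'; [split; lra|]. apply Rabs_def1; lra. }
assert (K * (b - a') <= K * (b - a)) by (apply Rmult_le_compat_l; lra).
assert (Tr := Rabs_triang (f b - f a') (f a' - f a)).
replace (f b - f a' + (f a' - f a)) with (f b - f a) in Tr by ring. lra.
Qed.

(** [U] is the region where the right-hand side makes sense; for the droplet it says that r > 0 and
    that the gas density differs from [rhoL]. *)
Definition ode_solution (F : R -> R -> R) (U : R -> R -> Prop) (r0 S : R)
    (y : R -> R) : Prop :=
  y 0 = r0 /\
  forall t, time_dom S t ->
    U t (y t) /\ D_in y (fun s => F s (y s)) (time_dom S) t.

Lemma ode_solution_restrict F U r0 S S' y :
  S' <= S -> ode_solution F U r0 S y -> ode_solution F U r0 S' y.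
Proof.
intros HS [H0 H]. split; [exact H0|]. intros t Ht.
assert (Ht' : time_dom S t) by (unfold time_dom in *; lra).
destruct (H t Ht') as [H1 H2]. split; [exact H1|].
apply (D_in_local y y (fun s => F s (y s)) _ (time_dom S) (time_dom S') t 1); auto; [lra|].
intros s Hs _. split; [|reflexivity]. unfold time_dom in *; lra.
Qed.

Lemma ode_local_existence T F U r0 d0 :
  0 < T -> 0 < d0 ->
  (forall t r, time_dom T t -> Rabs t < d0 -> Rabs (r - r0) < d0 -> U t r) ->
  regular_at (time_dom T) F 0 r0 ->
  exists S y, 0 < S <= T /\ ode_solution F U r0 S y.
Proof.
intros HT Hd0 HU [d1 [K [Hd1 [HK HF]]]].
(* Halving makes the closed box of radius [d] fit inside both open neighbourhoods. *)
set (d := Rmin d0 d1 / 2).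
assert (Hd : 0 < d /\ d < d0 /\ d < d1).
{ assert (0 < Rmin d0 d1) by now apply Rmin_glb_lt.
  assert (A1 := Rmin_l d0 d1). assert (A2 := Rmin_r d0 d1). unfold d. lra. }
clearbody d.
(* Times are clamped to [0,tau] with tau < T, so that they stay in [time_dom T]. *)
set (tau := Rmin d (T / 2)).
assert (Htau : 0 < tau /\ tau <= d /\ tau < T).
{ assert (0 < Rmin d (T / 2)) by (apply Rmin_glb_lt; lra).
  assert (A1 := Rmin_l d (T / 2)). assert (A2 := Rmin_r d (T / 2)). unfold tau. lra. }
clearbody tau.
(* K h <= 1/2 gives the contraction; K h <= d prevents a solution of speed at most [K] from leaving
   the box, so the clamps are inactive along it. *)
set (h := Rmin tau (Rmin (1 / 2) d / K)).
assert (Hm : 0 < Rmin (1 / 2) d) by (apply Rmin_glb_lt; lra).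
assert (Hh : 0 < h /\ h <= tau /\ K * h <= 1 / 2 /\ K * h <= d).
{ assert (0 < Rmin (1 / 2) d / K) by (apply Rdiv_lt_0_compat; lra).
  assert (0 < h) by (apply Rmin_glb_lt; lra).
  assert (h <= Rmin (1 / 2) d / K) by apply Rmin_r.
  assert (K * h <= Rmin (1 / 2) d).
  { replace (Rmin (1 / 2) d) with (K * (Rmin (1 / 2) d / K)) by (field; lra).
    apply Rmult_le_compat_l; lra. }
  assert (A1 := Rmin_l (1 / 2) d). assert (A2 := Rmin_r (1 / 2) d).
  assert (h <= tau) by apply Rmin_l. lra. }
clearbody h.
set (G := fun t r => F (clamp 0 tau t) (clamp (r0 - d) (r0 + d) r)).
assert (Ct : forall t, time_dom T (clamp 0 tau t) /\ Rabs (clamp 0 tau t - 0) < d1).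
{ intros t. assert (B := clamp_bounds 0 tau t ltac:(lra)).
  split; [split; lra|apply Rabs_def1; lra]. }
assert (Cr : forall r, Rabs (clamp (r0 - d) (r0 + d) r - r0) < d1).
{ intros r. assert (B := clamp_bounds (r0 - d) (r0 + d) r ltac:(lra)).
  apply Rabs_def1; lra. }
assert (GB : forall t r, Rabs (G t r) <= K).
{ intros t r. apply (HF _ (proj1 (Ct t)) (proj2 (Ct t)) _ (Cr r)). }
destruct (picard G r0 K K h) as [z [z0 Hz]]; try lra; auto.
- intros t r r'.
  destruct (HF _ (proj1 (Ct t)) (proj2 (Ct t)) _ (Cr r)) as [_ [_ L]].
  eapply Rle_trans; [apply L, Cr|].
  apply Rmult_le_compat_l; [lra|apply clamp_lipschitz].
- intros t r. apply continuous_intro. intros eps He.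
  destruct (Ct t) as [D1 D2].
  destruct (HF _ D1 D2 _ (Cr r)) as [_ [C _]].
  destruct (limit1_in_elim _ _ _ _ eps C He) as [e [Pe C']].
  exists e; split; [exact Pe|]. intros s Hs.
  apply C'; [apply Ct|]. eapply Rle_lt_trans; [apply clamp_lipschitz|exact Hs].
- exists h, z. split; [lra|]. split; [exact z0|]. intros t Ht. destruct (Ht) as [Ht0 Hth].
  assert (V : Rabs (z t - z 0) <= K * Rabs (t - 0)).
  { apply (mean_value_bound z (fun s => G s (z s))). intros x.
    rewrite Rmin_left, Rmax_right by lra. intros Hx.
    split; [apply Hz; lra|apply GB]. }
  rewrite z0, Rminus_0_r, (Rabs_pos_eq t) in V by lra.
  assert (V' : Rabs (z t - r0) <= d).
  { apply Rle_trans with (K * h); [|lra].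
    eapply Rle_trans; [exact V|]. apply Rmult_le_compat_l; lra. }
  split.
  + apply HU; [split; lra|rewrite Rabs_pos_eq; lra|lra].
  + apply (is_derive_D_in z (fun s => F s (z s))).
    assert (D := Hz t ltac:(lra)). unfold G in D.
    apply Rabs_le_between in V'.
    rewrite !clamp_id in D by lra. exact D.
Qed.

Lemma ode_local_uniqueness T F (U : R -> R -> Prop) r0 S y1 y2 a :
  (forall t r, time_dom T t -> U t r -> regular_at (time_dom T) F t r) ->
  S <= T -> ode_solution F U r0 S y1 -> ode_solution F U r0 S y2 ->
  time_dom S a -> y1 a = y2 a ->
  exists e, 0 < e /\ forall t, a <= t < a + e -> t < S -> y1 t = y2 t.
Proof.
intros F_regular HS [_ H1] [_ H2] Ha Ea.
assert (HaT : time_dom T a) by (unfold time_dom in *; lra).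
destruct (F_regular a (y1 a) HaT) as [d [K [Hd [HK HF]]]]; [now apply H1|].
assert (C1 : limit1_in y1 (time_dom S) (y1 a) a)
  by (eapply D_in_continuous; now apply H1).
assert (C2 : limit1_in y2 (time_dom S) (y2 a) a)
  by (eapply D_in_continuous; now apply H2).
destruct (limit1_in_elim _ _ _ _ d C1 Hd) as [e1 [He1 N1]].
destruct (limit1_in_elim _ _ _ _ d C2 Hd) as [e2 [He2 N2]].
rewrite <- Ea in N2.
assert (HK' : 0 < 1 / 2 / K) by (apply Rdiv_lt_0_compat; lra).
(* [e1], [e2] and [d] keep time and both solutions in the box around (a, y1 a) where [K] is valid;
   the last bound gives K e <= 1/2. *)
set (e := Rmin (Rmin e1 e2) (Rmin d (1 / 2 / K))).
assert (He : 0 < e /\ e <= e1 /\ e <= e2 /\ e <= d /\ K * e <= 1 / 2).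
{ assert (0 < e) by (unfold e; repeat apply Rmin_glb_lt; lra).
  assert (A1 : e <= Rmin e1 e2) by apply Rmin_l.
  assert (A2 : e <= Rmin d (1 / 2 / K)) by apply Rmin_r.
  assert (A3 := Rmin_l e1 e2). assert (A4 := Rmin_r e1 e2).
  assert (A5 := Rmin_l d (1 / 2 / K)). assert (A6 := Rmin_r d (1 / 2 / K)).
  assert (K * e <= K * (1 / 2 / K)) by (apply Rmult_le_compat_l; lra).
  replace (K * (1 / 2 / K)) with (1 / 2) in * by (field; lra). lra. }
clearbody e. unfold time_dom in Ha.
exists e. split; [lra|].
assert (Near : forall t, a <= t < a + e -> t < S ->
  time_dom S t /\ Rabs (t - a) < d /\ Rabs (y1 t - y1 a) < d /\ Rabs (y2 t - y1 a) < d).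
{ intros t Ht HtS. assert (Dt : time_dom S t) by (split; lra).
  split; [exact Dt|]. split; [apply Rabs_def1; lra|].
  split; [apply N1|apply N2]; auto; apply Rabs_def1; lra. }
(* On an interval of length e <= 1/(2K) a bound on |y1 - y2| can be halved. *)
assert (Half : forall n t, a <= t < a + e -> t < S ->
  Rabs (y1 t - y2 t) <= 2 * d * (1 / 2) ^ n).
{ induction n as [|n IH]; intros t Ht HtS.
  - destruct (Near t Ht HtS) as [_ [_ [B1 B2]]].
    assert (Tr := Rabs_triang (y1 t - y1 a) (y1 a - y2 t)).
    replace (y1 t - y1 a + (y1 a - y2 t)) with (y1 t - y2 t) in Tr by ring.
    rewrite (Rabs_minus_sym (y1 a) (y2 t)) in Tr. simpl. lra.
  - assert (P : 0 <= 2 * d * (1 / 2) ^ n)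
      by (apply Rmult_le_pos; [lra|apply pow_le; lra]).
    assert (V := D_in_mean_value_bound (fun s => y1 s - y2 s)
      (fun s => F s (y1 s) - F s (y2 s)) S a t (K * (2 * d * (1 / 2) ^ n))).
    cbv beta in V. rewrite Ea, Rminus_diag, Rminus_0_r in V.
    eapply Rle_trans; [apply V; [lra|lra|]|].
    + intros s Hs.
      destruct (Near s ltac:(lra) ltac:(lra)) as [Ds [Bs [B1 B2]]].
      split.
      * apply (Dminus (time_dom S) (fun s => F s (y1 s)) (fun s => F s (y2 s)) y1 y2);
          [now apply H1|now apply H2].
      * assert (DsT : time_dom T s) by (unfold time_dom in *; lra).
        destruct (HF s DsT Bs (y1 s) B1) as [_ [_ L]].
        eapply Rle_trans; [now apply L|].
        apply Rmult_le_compat_l; [lra|]. apply IH; lra.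
    + replace (K * (2 * d * (1 / 2) ^ n) * (t - a))
        with (2 * d * (1 / 2) ^ n * (K * (t - a))) by ring.
      replace (2 * d * (1 / 2) ^ Datatypes.S n)
        with (2 * d * (1 / 2) ^ n * (1 / 2)) by (simpl; ring).
      apply Rmult_le_compat_l; [exact P|].
      apply Rle_trans with (K * e); [|lra]. apply Rmult_le_compat_l; lra. }
intros t Ht HtS. apply Rminus_diag_uniq.
apply (geometric_bound_zero (2 * d)); [lra|]. intros n. now apply Half.
Qed.

(** Continuation argument: let m be the supremum of the times up to which the solutions agree.
    Agreement passes to m by continuity, and local uniqueness then carries it past m unless m =
    t1. *)
Lemma ode_uniqueness T F (U : R -> R -> Prop) r0 S y1 y2 t1 :
  (forall t r, time_dom T t -> U t r -> regular_at (time_dom T) F t r) ->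
  S <= T -> ode_solution F U r0 S y1 -> ode_solution F U r0 S y2 ->
  time_dom S t1 -> y1 t1 = y2 t1.
Proof.
intros F_regular HS Y1 Y2 [Ht1 Ht1S].
set (E := fun x => 0 <= x <= t1 /\ forall s, 0 <= s <= x -> y1 s = y2 s).
assert (E0 : E 0).
{ split; [lra|]. intros s Hs. replace s with 0 by lra.
  now rewrite (proj1 Y1), (proj1 Y2). }
destruct (completeness E) as [m [Hub Hlub]].
{ exists t1. intros x [Hx _]. lra. }
{ now exists 0. }
assert (Hm0 : 0 <= m) by now apply Hub.
assert (Hmt : m <= t1) by (apply Hlub; intros x [Hx _]; lra).
assert (Below : forall s, 0 <= s < m -> y1 s = y2 s).
{ intros s Hs. apply NNPP. intros N.
  assert (m <= s); [|lra]. apply Hlub. intros x [Hx Ex].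
  destruct (Rle_dec x s) as [|L]; [assumption|].
  exfalso; apply N, Ex. lra. }
assert (Dm : time_dom S m) by (split; lra).
assert (Em : y1 m = y2 m).
{ destruct (Req_dec m 0) as [->|Nm]; [now apply E0; lra|].
  apply Rminus_diag_uniq. apply NNPP. intros N.
  assert (C : limit1_in (fun s => y1 s - y2 s) (time_dom S) (y1 m - y2 m) m).
  { apply limit_minus; eapply D_in_continuous; [now apply Y1|now apply Y2]. }
  destruct (limit1_in_elim _ _ _ _ _ C (Rabs_pos_lt _ N)) as [e [He C']].
  set (s := Rmax 0 (m - e / 2)).
  assert (0 <= s) by apply Rmax_l.
  assert (m - e / 2 <= s) by apply Rmax_r.
  assert (s < m) by (apply Rmax_lub_lt; lra).
  clearbody s.
  specialize (C' s ltac:(split; lra) ltac:(apply Rabs_def1; lra)).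
  rewrite (Below s) in C' by lra.
  rewrite Rminus_diag, Rminus_0_l, Rabs_Ropp in C'. lra. }
destruct (ode_local_uniqueness T F U r0 S y1 y2 m F_regular HS Y1 Y2 Dm Em) as [e [He Loc]].
(* Truncating at [t1] keeps the new time in [E]; as it cannot exceed m, it forces m = t1. *)
assert (Up : E (Rmin t1 (m + e / 2))).
{ assert (A1 := Rmin_l t1 (m + e / 2)). assert (A2 := Rmin_r t1 (m + e / 2)).
  assert (A3 : 0 <= Rmin t1 (m + e / 2)) by (apply Rmin_glb; lra).
  split; [lra|]. intros s Hs.
  destruct (Rlt_dec s m); [apply Below|apply Loc]; lra. }
assert (Hle := Hub _ Up).
destruct (Req_dec t1 m) as [->|N]; [exact Em|].
exfalso. unfold Rmin in Hle. destruct (Rle_dec t1 (m + e / 2)); lra.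
Qed.

(** The solutions form a compatible family by uniqueness, so their union is a solution up to the
    supremum of their lifespans. The last hypothesis is needed at the start only: it makes [U] a
    neighbourhood of the initial point. *)
Lemma ode_maximal_solution T F (U : R -> R -> Prop) r0 d0 :
  (forall t r, time_dom T t -> U t r -> regular_at (time_dom T) F t r) ->
  0 < T -> 0 < d0 ->
  (forall t r, time_dom T t -> Rabs t < d0 -> Rabs (r - r0) < d0 -> U t r) ->
  exists Tstar y,
    0 < Tstar <= T /\ ode_solution F U r0 Tstar y /\
    forall S y', 0 < S <= T -> ode_solution F U r0 S y' ->
      S <= Tstar /\ forall t, 0 <= t < S -> y' t = y t.
Proof.
intros F_regular HT Hd0 HU.
set (E := fun S => 0 < S <= T /\ exists y, ode_solution F U r0 S y).
destruct (ode_local_existence T F U r0 d0) as [S0 [y0 [HS0 Hy0]]]; auto.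
{ assert (D0 : time_dom T 0) by (split; lra).
  apply F_regular; [exact D0|].
  apply HU; [exact D0|rewrite Rabs_R0; lra|rewrite Rminus_diag, Rabs_R0; lra]. }
assert (ES0 : E S0) by (split; eauto).
destruct (completeness E) as [Ts [Hub Hlub]].
{ exists T. intros x [Hx _]. lra. }
{ now exists S0. }
assert (HTs : 0 < Ts <= T).
{ split; [apply Rlt_le_trans with S0; [lra|now apply Hub]|].
  apply Hlub. intros x [Hx _]. lra. }
set (value := fun t x => exists S y,
  0 < S <= T /\ t < S /\ ode_solution F U r0 S y /\ x = y t).
(* The union of the family is defined by choice; for t in [0,Ts[ uniqueness makes the chosen value
   independent of the solution that supplies it. *)
set (y := fun t => epsilon (inhabits 0) (value t)).
assert (Agree : forall S y', 0 < S <= T -> ode_solution F U r0 S y' ->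
  forall t, 0 <= t < S -> y' t = y t).
{ intros S y' HS Hy' t Ht.
  assert (V : value t (y t)).
  { apply epsilon_spec. exists (y' t), S, y'.
    split; [exact HS|]. split; [lra|]. split; [exact Hy'|reflexivity]. }
  destruct V as [S2 [y2 [HS2 [Ht2 [Hy2 ->]]]]].
  apply (ode_uniqueness T F U r0 (Rmin S S2)); [exact F_regular| | | |].
  - apply Rle_trans with S; [apply Rmin_l|lra].
  - eapply ode_solution_restrict; [apply Rmin_l|exact Hy'].
  - eapply ode_solution_restrict; [apply Rmin_r|exact Hy2].
  - split; [lra|]. apply Rmin_glb_lt; lra. }
exists Ts, y. split; [exact HTs|]. split.
- split.
  { rewrite <- (Agree S0 y0 HS0 Hy0) by lra. apply Hy0. }
  intros t Ht.
  assert (HSt : exists S, E S /\ t < S).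
  { apply NNPP. intros N. destruct Ht as [_ Ht].
    assert (Ts <= t); [|lra]. apply Hlub. intros x Ex.
    destruct (Rle_dec x t); [assumption|]. exfalso; apply N. exists x; split; [exact Ex|lra]. }
  destruct HSt as [S [[HS [y' Hy']] HtS]]. destruct Ht as [Ht0 HtT].
  assert (A := Agree S y' HS Hy').
  destruct (proj2 Hy' t) as [U1 D1]; [split; lra|].
  rewrite <- A by lra. split; [exact U1|].
  (* [y'] lives up to S > t, so within distance S - t of t it is defined and coincides with [y]. *)
  apply (D_in_local y' y (fun s => F s (y' s)) _ (time_dom S) (time_dom Ts) t (S - t)).
  + lra.
  + split; lra.
  + intros s [Hs _] Hst. apply Rabs_def2 in Hst.
    assert (Hs' : 0 <= s < S) by lra. split; [exact Hs'|]. symmetry; now apply A.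
  + now rewrite <- A by lra.
  + exact D1.
- intros S y' HS Hy'. split; [apply Hub; split; eauto|]. now apply Agree.
Qed.

(** * The equation of the droplet radius *)

Theorem proposition3 (gamma rhoL R0 T : R) (rho0 v0 : R -> R)
    (rhoG vG : R -> R -> R)
    (hgamma : 1 < gamma) (hrhoL : 0 < rhoL) (hR0 : 0 < R0) (hT : 0 < T)
    (hrho0 : C1_Rplus rho0) (hv0 : C1_Rplus v0)
    (hneg : let W0 := fun r => riemannW gamma (r ^ 2 * rho0 r) (v0 r) in
            let Z0 := fun r => riemannZ gamma (r ^ 2 * rho0 r) (v0 r) in
            exists r, 0 < r /\
              ((ex_derive W0 r /\ Derive W0 r < 0) \/
               (ex_derive Z0 r /\ Derive Z0 r < 0)))
    (hgas : gas_solution gamma T rhoG vG)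
    (hinit : forall r, 0 < r -> rhoG 0 r = rho0 r /\ vG 0 r = v0 r)
    (hdef : rho0 R0 <> rhoL) :
  exists (Tstar : R) (Rad : R -> R),
    0 < Tstar <= T /\
    radius_solution rhoG vG rhoL R0 Tstar Rad /\
    (forall (S : R) (Rad' : R -> R),
       0 < S <= T -> radius_solution rhoG vG rhoL R0 S Rad' ->
       S <= Tstar /\ (forall t, 0 <= t < S -> Rad' t = Rad t)).
Proof.
destruct hgas as [_ [rho_t [rho_r [v_t [v_r [Crho [Cv _]]]]]]].
set (F := fun t r => vG t r * rhoG t r / (rhoG t r - rhoL)).
set (U := fun t r => 0 < r /\ rhoG t r <> rhoL).
assert (Req : forall S y,
  radius_solution rhoG vG rhoL R0 S y <-> ode_solution F U R0 S y).
{ intros S y. split; intros [H0 H]; (split; [exact H0|]); intros t Ht;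
    specialize (H t Ht); unfold U in *; tauto. }
assert (Reg_id : forall t r, regular_at (time_dom T) (fun _ x => x) t r).
{ intros t r. apply (regular_at_time_independent _ (fun x => x) 1). intros; lra. }
assert (Reg_rho : forall t r, gas_dom T (t, r) -> regular_at (time_dom T) rhoG t r).
{ intros t r Htr. destruct (Htr) as [Dt Pr]; simpl in Dt, Pr.
  (* The gas system gives C^1 regularity for r^2 [rhoG]; [rhoG] is recovered by multiplying by 1/r
     twice, and the neighbourhood of radius r avoids the origin. *)
  apply (regular_at_ext _ (fun t r => r ^ 2 * rhoG t r * (/ r * / r)) _ _ _ r Pr).
  { intros s x _ Hx. apply Rabs_def2 in Hx. field. lra. }
  assert (Hr : r <> 0) by lra.
  apply regular_at_mul; [exact (regular_at_C1 _ _ _ _ _ _ Crho Htr)|].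
  apply (regular_at_mul _ (fun _ x => / x) (fun _ x => / x));
    apply (regular_at_inv _ (fun _ x => x)); auto. }
assert (Reg_diff : forall t r, gas_dom T (t, r) ->
  regular_at (time_dom T) (fun t r => rhoG t r - rhoL) t r).
{ intros t r Htr. apply (regular_at_sub _ rhoG (fun _ _ => rhoL)); [auto|].
  apply (regular_at_time_independent _ (fun _ => rhoL) 0).
  intros. rewrite Rminus_diag, Rabs_R0. lra. }
assert (Reg_F : forall t r, time_dom T t -> U t r -> regular_at (time_dom T) F t r).
{ intros t r Dt [Pr N]. assert (Htr : gas_dom T (t, r)) by (split; assumption).
  apply (regular_at_mul _ (fun t r => vG t r * rhoG t r) (fun t r => / (rhoG t r - rhoL))).
  - apply regular_at_mul; [exact (regular_at_C1 _ _ _ _ _ _ Cv Htr)|auto].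
  - apply (regular_at_inv _ (fun t r => rhoG t r - rhoL)); auto. lra. }
assert (D0 : time_dom T 0) by (split; lra).
(* Since [rhoG 0 R0] equals [rho0 R0], [hdef] makes the denominator nonzero at the start, hence
   bounded away from 0 nearby. *)
destruct (regular_at_lower_bound _ _ _ _ D0 (Reg_diff 0 R0 (conj D0 hR0)))
  as [d [m [Hd [Hm Low]]]].
{ rewrite (proj1 (hinit R0 hR0)). lra. }
(* [d] keeps the density away from [rhoL], and [R0] keeps the radius positive. *)
destruct (ode_maximal_solution T F U R0 (Rmin d R0) Reg_F) as [Ts [y [HT [Hy Max]]]].
- exact hT.
- now apply Rmin_glb_lt.
- intros t r Dt Ht Hr. apply Rmin_Rgt in Ht. apply Rmin_Rgt in Hr.
  destruct Hr as [Hr Hr']. apply Rabs_def2 in Hr'. split; [lra|].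
  intros Eq. assert (L := Low t r Dt).
  rewrite Rminus_0_r, Eq, Rminus_diag, Rabs_R0 in L.
  specialize (L (proj1 Ht) Hr). lra.
- exists Ts, y. split; [exact HT|]. split; [now apply Req|].
  intros S y' HS Hy'. apply Max; [exact HS|now apply Req].
Qed.
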